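(* Let $k>2$ and $n$ be positive integers, and let $A$ be a generalized Cartan matrix of type $N_{k,n}$. Then $A$ has a principal submatrix of type $N_{k-1,n-1}$.
   Context: A generalized Cartan matrix (GCM) is an $\ell\times\ell$ integer matrix $A=(a_{ij})$ with $a_{ii}=2$, $a_{ij}\le 0$ for $i\neq j$, and $a_{ij}=0$ if and only if $a_{ji}=0$; its dimension is $\ell$. A principal submatrix is obtained by deleting some rows and the columns with the same indices. GCMs are assumed symmetrizable (some invertible diagonal $D$ makes $DA$ symmetric) and indecomposable (not block diagonal after a simultaneous permutation of rows and columns). Vector inequalities are entrywise. An indecomposable GCM is of finite type if $\det A\neq0$, there is $u>0$ with $Au>0$, and $Au\ge0$ implies $u>0$ or $u=0$; of affine type if $\operatorname{corank}A=1$, there is $u>0$ with $Au=0$, and $Au\ge0$ implies $Au=0$. It is hyperbolic if it is neither finite nor affine but every proper indecomposable principal submatrix is finite or affine. Type $N_0$ = finite, $N_1$ = affine, $N_2$ = hyperbolic; for $k\ge3$, a GCM is of type $N_k$ if it contains at least one principal submatrix of type $N_{k-1}$ and every other (indecomposable) principal submatrix is of type $N_m$ for some $m<k$. Type $N_{k,n}$ means type $N_k$ and dimension $n$. *)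

(* Defs.v *)
From mathcomp Require Import all_boot all_order all_fingroup all_algebra.
From mathcomp Require Import reals.

Set Implicit Arguments.
Unset Strict Implicit.
Unset Printing Implicit Defensive.

Import Order.TTheory GRing.Theory Num.Theory.
Local Open Scope ring_scope.

(* Rows and columns outside S are deleted; enum_val lists S increasingly. *)
Definition psubmx (n : nat) (S : {set 'I_n}) (A : 'M[int]_n) : 'M[int]_#|S| :=
  mxsub (@enum_val _ (mem S)) (@enum_val _ (mem S)) A.

Definition is_gcm (n : nat) (A : 'M[int]_n) : Prop :=
  [/\ forall i, A i i = 2,
      forall i j, i != j -> A i j <= 0
    & forall i j, A i j = 0 <-> A j i = 0].

(* Two diagonal blocks, of sizes p and n - p. *)
Definition block_diag_at (p n : nat) (A : 'M[int]_n) : Prop :=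
  forall i j : 'I_n, (i < p)%N != (j < p)%N -> A i j = 0.

(* The empty matrix is not indecomposable. *)
Definition indecomposable (n : nat) (A : 'M[int]_n) : Prop :=
  (0 < n)%N /\
  ~ exists (s : 'S_n) (p : nat),
      (0 < p < n)%N /\ block_diag_at p (row_perm s (col_perm s A)).

Section Types.

Variable R : realType.

Definition realmx (n : nat) (A : 'M[int]_n) : 'M[R]_n := map_mx intr A.

Definition symmetrizable (n : nat) (A : 'M[int]_n) : Prop :=
  exists D : 'M[R]_n,
    [/\ is_diag_mx D, D \in unitmx & (D *m realmx A)^T = D *m realmx A].

Definition standing (n : nat) (A : 'M[int]_n) : Prop :=
  [/\ is_gcm A, symmetrizable A & indecomposable A].

Definition pos_vec (n : nat) (u : 'cV[R]_n) : Prop := forall i, 0 < u i 0.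
Definition nneg_vec (n : nat) (u : 'cV[R]_n) : Prop := forall i, 0 <= u i 0.

Definition finite_type (n : nat) (A : 'M[int]_n) : Prop :=
  [/\ standing A,
      \det A != 0,
      exists2 u : 'cV[R]_n, pos_vec u & pos_vec (realmx A *m u)
    & forall u : 'cV[R]_n,
        nneg_vec (realmx A *m u) -> pos_vec u \/ u = 0].

Definition affine_type (n : nat) (A : 'M[int]_n) : Prop :=
  [/\ standing A,
      (n - \rank (realmx A))%N = 1%N,
      exists2 u : 'cV[R]_n, pos_vec u & realmx A *m u = 0
    & forall u : 'cV[R]_n,
        nneg_vec (realmx A *m u) -> realmx A *m u = 0].

Definition hyperbolic_type (n : nat) (A : 'M[int]_n) : Prop :=
  [/\ standing A, ~ finite_type A, ~ affine_type A
    & forall T : {set 'I_n}, T \proper [set: 'I_n] ->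
        indecomposable (psubmx T A) ->
        finite_type (psubmx T A) \/ affine_type (psubmx T A)].

(* The principal submatrices in the last clause have to be proper: A itself
   cannot be required to be of type N_m with m < k. *)
Inductive typeN (n : nat) (A : 'M[int]_n) : nat -> Prop :=
  | typeN_finite of finite_type A : typeN A 0
  | typeN_affine of affine_type A : typeN A 1
  | typeN_hyperbolic of hyperbolic_type A : typeN A 2
  | typeN_rec (k : nat) (S : {set 'I_n}) of
      (2 < k)%N & standing A
      & S \proper [set: 'I_n] & typeN (psubmx S A) k.-1
      & (forall T : {set 'I_n}, T \proper [set: 'I_n] -> T != S ->
           indecomposable (psubmx T A) ->
           exists2 m : nat, (m < k)%N & typeN (psubmx T A) m) :
      typeN A k.

Definition typeNd (k d n : nat) (A : 'M[int]_n) : Prop := typeN A k /\ n = d.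

End Types.

(* Main.v *)
(** Adding to a proper connected index set [S] an adjacent vertex keeps it
    connected.  If [S] carries the type [N_(k-1)] submatrix and has fewer than
    [n - 1] elements, the enlarged set [T] is still proper, so it has some type
    [N_m] with [m < k], and then [S], as a proper part of [T], also has a type
    below [k - 1].  This contradicts the uniqueness of the type, which follows by
    induction on the dimension from the fact that proper indecomposable
    principal submatrices of finite or affine matrices are of finite type. *)

Require Import Defs.
From mathcomp Require Import all_boot all_order all_fingroup all_algebra.
From mathcomp Require Import reals.

Set Implicit Arguments.
Unset Strict Implicit.
Unset Printing Implicit Defensive.

Import Order.TTheory GRing.Theory Num.Theory.
(* [mathcomp] also has a [realmx]. *)
Import Defs.
Local Open Scope ring_scope.

(** * Indecomposability as connectedness of the graph of nonzero entries *)

Lemma map_enum_val (T : finType) (A : {pred T}) :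
  map (@enum_val T A) (enum 'I_#|A|) = enum A.
Proof.
have szE : size (map (@enum_val T A) (enum 'I_#|A|)) = size (enum A).
  by rewrite size_map size_enum_ord cardE.
case: (pickP A) => [x0 _ | A0]; last first.
  by rewrite (eq_enum A0) enum0 in szE *; apply: size0nil.
apply: (@eq_from_nth _ x0) => // i; rewrite szE -cardE => ltiA.
rewrite (nth_map (Ordinal ltiA)) ?size_enum_ord //.
by rewrite (enum_val_nth x0) nth_enum_ord.
Qed.

(** The blocks of [block_diag_at] are initial segments, so an arbitrary vertex set has to be moved
    to the front. *)
Lemma perm_initial_segment n (X : {set 'I_n}) :
  exists s : 'S_n, forall i, (s i \in X) = (i < #|X|)%N.
Proof.
pose e := enum X ++ enum (~: X).
have sz_e : size e = n.
  by rewrite size_cat -!cardE cardsC card_ord.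
have e_uniq : uniq e.
  rewrite cat_uniq !enum_uniq andbT /=; apply/hasPn => x.
  by rewrite !mem_enum inE.
have nth_inj : injective (fun i : 'I_n => nth i e i).
  move=> i j; rewrite (set_nth_default j) ?sz_e // => /eqP.
  by rewrite nth_uniq ?sz_e // => /eqP/val_inj.
exists (perm nth_inj) => i; rewrite permE nth_cat -cardE.
case: ltnP => [ltiX | leXi].
  by rewrite -mem_enum mem_nth // -cardE.
apply/negbTE; rewrite -in_setC -mem_enum mem_nth // -cardE.
by rewrite ltn_subLR // cardsC card_ord.
Qed.

(** If no edge left [X], the symmetry of the zero pattern would kill both off-diagonal blocks once
    [X] is permuted to the front. *)
Lemma indecomposable_edge n (A : 'M[int]_n) (X : {set 'I_n}) :
  is_gcm A -> indecomposable A -> X != set0 -> X != setT ->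
  exists i j, [/\ i \in X, j \notin X & A i j != 0].
Proof.
move=> [_ _ A0] [n_gt0 indecA] X0 XT.
case: (boolP [exists i, exists j, [&& i \in X, j \notin X & A i j != 0]]).
  by case/existsP=> i /existsP[j /and3P[]]; exists i, j.
move=> /existsPn noedge; case: indecA.
have A_X0 i j : i \in X -> j \notin X -> A i j = 0.
  move=> iX jX; apply/eqP; move: (noedge i) => /existsPn/(_ j).
  by rewrite iX jX /= negbK.
have [s sX] := perm_initial_segment X; exists s, #|X|; split.
  rewrite card_gt0 X0 /= -[X in (_ < X)%N]card_ord -cardsT.
  by apply: proper_card; rewrite properT.
move=> i j; rewrite !mxE -!sX.
case iX: (s i \in X); case jX: (s j \in X) => // _.
  by apply: A_X0; rewrite ?iX ?jX.
by apply/A0/A_X0; rewrite ?iX ?jX.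
Qed.

Lemma edge_indecomposable n (A : 'M[int]_n) :
  (0 < n)%N ->
  (forall X : {set 'I_n}, X != set0 -> X != setT ->
     exists i j, [/\ i \in X, j \notin X & A i j != 0]) ->
  indecomposable A.
Proof.
move=> n_gt0 edge; split=> // -[s [p [/andP[p_gt0 ltpn] bdA]]].
(* The cut is the first block, pulled back to the original indices. *)
have [||i [j [+ + /eqP]]] := edge [set x | (s^-1%g x < p)%N].
- by apply/set0Pn; exists (s (Ordinal n_gt0)); rewrite inE permK.
- apply/eqP => /setP/(_ (s (Ordinal ltpn))).
  by rewrite !inE permK /= ltnn.
rewrite !inE => ip jp; apply.
have := bdA (s^-1%g i) (s^-1%g j).
by rewrite !mxE !permKV ip (negbTE jp); apply.
Qed.

(** * Connected index sets and nested principal submatrices *)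

Section PrincipalSubmatrix.

Variables (n : nat) (A : 'M[int]_n).
Implicit Types S T : {set 'I_n}.

Lemma psubmx_gcm S : is_gcm A -> is_gcm (psubmx S A).
Proof.
move=> [A2 Ale A0]; split=> [i|i j neq_ij|i j]; rewrite !mxE //.
by apply: Ale; rewrite (inj_eq enum_val_inj).
Qed.

Lemma psubmx_symmetrizable (R : realType) S :
  symmetrizable R A -> symmetrizable R (psubmx S A).
Proof.
move=> [D [/diag_mxP[d defD] Dunit Dsym]].
exists (mxsub (@enum_val _ (mem S)) (@enum_val _ (mem S)) D).
have -> : mxsub (@enum_val _ (mem S)) (@enum_val _ (mem S)) D =
          diag_mx (\row_j d 0 (@enum_val _ (mem S) j)).
  by apply/matrixP=> i j; rewrite defD !mxE (inj_eq enum_val_inj).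
split; first exact: diag_mx_is_diag.
  move: Dunit; rewrite !unitmxE defD !det_diag !unitfE => /prodf_neq0 d_neq0.
  by apply/prodf_neq0 => i _; rewrite mxE d_neq0.
apply/matrixP=> i j; move: Dsym => /matrixP/(_ (enum_val i) (enum_val j)).
by rewrite defD !mul_diag_mx !mxE.
Qed.

Lemma psubmx_standing (R : realType) S :
  standing R A -> indecomposable (psubmx S A) -> standing R (psubmx S A).
Proof.
case=> gcmA symA _; split=> //; first exact: psubmx_gcm.
exact: psubmx_symmetrizable.
Qed.

Lemma indecomposable_psubmx_edge S (X : {set 'I_n}) :
  is_gcm A -> indecomposable (psubmx S A) ->
  X \subset S -> X != set0 -> X != S ->
  exists i j, [/\ i \in X, j \in S :\: X & A i j != 0].
Proof.
move=> gcmA indecS /subsetP XS /set0Pn[x xX] neqXS.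
have xS := XS x xX.
pose Y := [set i : 'I_#|S| | @enum_val _ (mem S) i \in X].
have [||i [j [iY jY Aij]]] :=
  indecomposable_edge (X := Y) (psubmx_gcm S gcmA) indecS.
- by apply/set0Pn; exists (enum_rank_in xS x); rewrite inE enum_rankK_in.
- apply: contra neqXS => /eqP defY; apply/eqP/setP => y.
  apply/idP/idP => [/XS // | yS].
  have := in_setT (enum_rank_in xS y).
  by rewrite -defY inE enum_rankK_in.
exists (enum_val i), (enum_val j); rewrite !inE in iY jY *.
by rewrite iY jY enum_valP; split=> //; rewrite mxE in Aij.
Qed.

Lemma edge_indecomposable_psubmx S :
  S != set0 ->
  (forall X : {set 'I_n}, X \subset S -> X != set0 -> X != S ->
     exists i j, [/\ i \in X, j \in S :\: X & A i j != 0]) ->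
  indecomposable (psubmx S A).
Proof.
move=> S0 edge; apply: edge_indecomposable; first by rewrite card_gt0.
move=> X /set0Pn[x xX] XT.
have [|||i [j [iX jX Aij]]] := edge (@enum_val _ (mem S) @: X).
- by apply/subsetP=> _ /imsetP[y _ ->]; exact: enum_valP.
- by apply/set0Pn; exists (enum_val x); apply: imset_f.
- apply: contra XT => /eqP defS; apply/eqP/setP=> y; rewrite in_setT.
  by rewrite -(mem_imset _ _ enum_val_inj) defS enum_valP.
case/imsetP: iX Aij => i' i'X -> Aij; case/setDP: jX => jS jX.
exists i', (enum_rank_in jS j); split=> //; last by rewrite mxE enum_rankK_in.
apply: contra jX => jX; rewrite -[j](enum_rankK_in jS) //.
exact: imset_f.
Qed.

Lemma indecomposable_psubmx_neq0 S : indecomposable (psubmx S A) -> S != set0.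
Proof. by case=> S_gt0 _; rewrite -card_gt0. Qed.

(** A cut [X] of [j |: S] either misses [S], and is then [[set j]], or contains [S], or cuts [S]
    properly. The edge between [i] and [j] crosses it in the first two cases, an edge inside [S] in
    the third. *)
Lemma indecomposable_psubmxU1 S i j :
  is_gcm A -> indecomposable (psubmx S A) ->
  i \in S -> j \notin S -> A i j != 0 -> indecomposable (psubmx (j |: S) A).
Proof.
move=> gcmA indecS iS jS Aij; have [_ _ A0] := gcmA.
have Aji : A j i != 0 by apply: contra Aij => /eqP/A0->.
have neq_ij : i != j by apply: contraNneq jS => <-.
apply: edge_indecomposable_psubmx => [|X XjS X0 XnjS].
  by apply/set0Pn; exists j; rewrite !inE eqxx.
have [XS0 | XS0] := eqVneq (X :&: S) set0.
  have defX : X = [set j].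
    apply/eqP; rewrite eqEsubset sub1set.
    have sXj : X \subset [set j].
      apply/subsetP=> x xX; have := subsetP XjS x xX; rewrite !inE.
      case/orP=> // xS; have := in_set0 x.
      by rewrite -XS0 inE xX xS.
    rewrite sXj; case/set0Pn: X0 => x xX.
    by rewrite -(set1P (subsetP sXj x xX)).
  by exists j, i; rewrite defX !inE eqxx iS (negbTE neq_ij) orbT.
have [XS | XS] := eqVneq (X :&: S) S.
  have sSX : S \subset X by rewrite -XS subsetIl.
  exists i, j; rewrite (subsetP sSX) // !inE eqxx andbT; split=> //.
  apply: contra XnjS => jX.
  by rewrite eqEsubset XjS subUset sub1set jX.
have [x [y [+ + Axy]]] :=
  indecomposable_psubmx_edge gcmA indecS (subsetIr X S) XS0 XS.
rewrite !inE => /andP[xX xS] /andP[+ yS]; rewrite yS andbT => yX.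
by exists x, y; rewrite xX !inE yS yX orbT.
Qed.

(** Both enumerations are increasing, so the entries agree without any permutation. The cast is
    there because the two cardinals are only provably equal. *)
Lemma psubmx_nested S T : S \subset T ->
  exists (S' : {set 'I_#|T|}) (e : #|S'| = #|S|),
    castmx (e, e) (psubmx S' (psubmx T A)) = psubmx S A.
Proof.
move=> /subsetP sST.
pose S' := [set i : 'I_#|T| | @enum_val _ (mem T) i \in S].
have enumS : map (@enum_val _ (mem T)) (enum S') = enum S.
  have -> : enum S = filter (mem S) (enum T).
    rewrite /enum_mem -filter_predI; apply: eq_filter => x /=.
    by apply/idP/andP => [xS | [] //]; split=> //; apply: sST.
  have -> : enum T = map (@enum_val _ (mem T)) (enum 'I_#|T|).
    exact/esym/map_enum_val.
  rewrite filter_map; congr map; rewrite enumT /enum_mem.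
  by apply: eq_filter => i; rewrite /= inE.
have e : #|S'| = #|S| by rewrite (cardE S) -enumS size_map -cardE.
have valE (i : 'I_#|S|) :
    enum_val (enum_val (cast_ord (esym e) i)) = enum_val i :> 'I_n.
  set d := enum_val i; set d' := (X in enum_val X).
  have -> : d = nth d (enum S) i by exact: enum_val_nth.
  rewrite -enumS (nth_map d') -?cardE ?e //.
  apply: (congr1 (@enum_val _ (mem T))); exact: enum_val_nth.
by exists S', e; apply/matrixP=> i j; rewrite castmxE !mxE !valE.
Qed.

End PrincipalSubmatrix.

(** * Finite type from a positive vector *)

Section FiniteAffine.

Variable R : realType.

Lemma realmx_mulE n (A : 'M[int]_n) (u : 'cV[R]_n) i :
  (realmx R A *m u) i 0 = \sum_j (A i j)%:~R * u j 0.
Proof. by rewrite mxE; apply: eq_bigr => j _; rewrite mxE. Qed.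

(* A nonnegative vector [w] with [w i = 0] and [A w >= 0] vanishes at the
   neighbours of [i], so its zero set is a union of components. *)
Lemma nneg_vec_eq0 n (A : 'M[int]_n) (w : 'cV[R]_n) i :
  is_gcm A -> indecomposable A ->
  nneg_vec w -> nneg_vec (realmx R A *m w) -> w i 0 = 0 -> w = 0.
Proof.
move=> gcmA indecA w_ge0 Aw_ge0 wi0; have [_ Ale _] := gcmA.
pose X := [set x | w x 0 == 0].
have [XT | XT] := eqVneq X setT.
  apply/matrixP=> x y; rewrite ord1 mxE; apply/eqP.
  by have := in_setT x; rewrite -XT inE.
have [|x [y []]] := indecomposable_edge gcmA indecA _ XT.
  by apply/set0Pn; exists i; rewrite inE wi0.
rewrite !inE => /eqP wx0 wy0 Axy.
have := Aw_ge0 x; rewrite realmx_mulE leNgt => /negP[].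
have neq_xy : x != y by apply: contraNneq wy0 => <-; rewrite wx0.
rewrite (bigD1 y) //=; apply: ltr_wnDr.
  apply: sumr_le0 => z _; have [<- | neq_xz] := eqVneq x z.
    by rewrite wx0 mulr0.
  by rewrite mulr_le0_ge0 ?lerz0 ?Ale.
rewrite nmulr_rlt0 ?lt0r ?wy0 ?w_ge0 //.
by rewrite ltrz0 lt_neqAle Axy Ale.
Qed.

(** A minimum principle: subtracting from [v] the largest multiple of [u] that leaves it nonnegative
    produces a zero entry, to which [nneg_vec_eq0] applies. *)
Lemma finite_type_of_superharmonic n (A : 'M[int]_n) (u : 'cV[R]_n) i0 :
  standing R A -> pos_vec u -> nneg_vec (realmx R A *m u) ->
  0 < (realmx R A *m u) i0 0 -> finite_type R A.
Proof.
move=> stA u_gt0 Au_ge0 Au_gt0; have [gcmA _ indecA] := stA.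
have monotone (v : 'cV[R]_n) : nneg_vec (realmx R A *m v) -> pos_vec v \/ v = 0.
  move=> Av_ge0.
  have [i _ /(_ _ isT) ler_i] :=
    @arg_minP _ _ 'I_n i0 predT (fun i => v i 0 / u i 0) isT.
  set t := v i 0 / u i 0 in ler_i.
  have w_ge0 : nneg_vec (v - t *: u).
    by move=> j; rewrite !mxE subr_ge0 -ler_pdivlMr // ler_i.
  have wi0 : (v - t *: u) i 0 = 0.
    by rewrite !mxE divfK ?subrr // gt_eqF.
  (* If [t > 0], then [v >= t u > 0]. Otherwise [- t A u >= 0], so [v - t u] vanishes, and the
     strict inequality at [i0] forces [t = 0]. *)
  have [t_gt0 | t_le0] := ltP 0 t.
    left=> j; have := w_ge0 j; rewrite !mxE subr_ge0; apply: lt_le_trans.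
    by rewrite mulr_gt0.
  right; have /eqP : v - t *: u = 0.
    apply: (nneg_vec_eq0 gcmA indecA w_ge0) wi0 => j.
    rewrite mulmxBr -scalemxAr; move: (Av_ge0 j) (Au_ge0 j).
    move: (realmx R A *m v) (realmx R A *m u) => a b aj bj.
    by rewrite !mxE subr_ge0; apply: le_trans aj; rewrite mulr_le0_ge0.
  rewrite subr_eq0 => /eqP def_v.
  have := Av_ge0 i0; rewrite def_v -scalemxAr mxE pmulr_lge0 // => t_ge0.
  by have -> : t = 0 by [apply/eqP; rewrite eq_le t_le0]; rewrite scale0r.
(* For [v] in the kernel, [monotone] applies to both [v] and [- v], which cannot both be
   positive. *)
have unitA : realmx R A \in unitmx.
  rewrite -unitmx_tr -row_free_unit -kermx_eq0; apply/rowV0P => v /sub_kermxP.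
  move=> /(congr1 trmx); rewrite trmx_mul trmxK trmx0 => Av0.
  have [|v_gt0|/(congr1 trmx)] := monotone v^T.
  - by move=> j; rewrite Av0 mxE.
  - have [|Nv_gt0|/eqP] := monotone (- v^T).
    + by move=> j; rewrite mulmxN Av0 oppr0 mxE.
    + have := v_gt0 i0; have := Nv_gt0 i0; rewrite mxE oppr_gt0 => lt0.
      by move/(lt_trans lt0); rewrite ltxx.
    + by rewrite oppr_eq0 => /eqP/(congr1 trmx); rewrite trmxK trmx0.
  - by rewrite trmxK trmx0.
split=> //.
  by move: unitA; rewrite unitmxE det_map_mx unitfE intr_eq0.
(* The preimage of a positive vector is nonzero, hence positive by [monotone]. *)
pose b : 'cV[R]_n := const_mx 1.
have Ab : realmx R A *m (invmx (realmx R A) *m b) = b by rewrite mulKVmx.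
exists (invmx (realmx R A) *m b); last by move=> j; rewrite Ab mxE ltr01.
have [|//|eq0] := monotone (invmx (realmx R A) *m b).
  by move=> j; rewrite Ab mxE ler01.
move: Ab; rewrite eq0 mulmx0 => /matrixP/(_ i0 0).
by rewrite !mxE => /eqP; rewrite eq_sym oner_eq0.
Qed.

(** Restricting [u] to [T] drops only nonpositive terms from [A u], and a strictly negative one in a
    row with an edge leaving [T]. *)
Lemma psubmx_finite_type n (A : 'M[int]_n) (u : 'cV[R]_n) (T : {set 'I_n}) :
  standing R A -> pos_vec u -> nneg_vec (realmx R A *m u) ->
  T \proper [set: 'I_n] -> indecomposable (psubmx T A) ->
  finite_type R (psubmx T A).
Proof.
move=> stA u_gt0 Au_ge0; rewrite properT => TnT indecT.
have [gcmA _ indecA] := stA; have [_ Ale _] := gcmA.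
pose v : 'cV[R]_#|T| := \col_i u (enum_val i) 0.
have AvE i : (realmx R (psubmx T A) *m v) i 0 =
    (realmx R A *m u) (enum_val i) 0
    - \sum_(j | j \notin T) (A (enum_val i) j)%:~R * u j 0.
  rewrite !realmx_mulE (bigID (mem T)) /= addrK.
  rewrite [RHS](big_enum_val (A := mem T)
    (fun j => (A (enum_val i) j)%:~R * u j 0)).
  by apply: eq_bigr => j _; rewrite !mxE.
have term_le0 i j : i \in T -> j \notin T -> (A i j)%:~R * u j 0 <= 0 :> R.
  move=> iT jT; rewrite pmulr_lle0 // lerz0 Ale //.
  by apply: contraNneq jT => <-.
have [x [y [xT yT Axy]]] :=
  indecomposable_edge gcmA indecA (indecomposable_psubmx_neq0 indecT) TnT.
apply: (@finite_type_of_superharmonic _ _ v (enum_rank_in xT x)).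
- exact: psubmx_standing.
- by move=> i; rewrite mxE.
- move=> i; rewrite AvE subr_ge0; apply: le_trans (Au_ge0 _).
  by apply: sumr_le0 => j; apply: term_le0; apply: enum_valP.
- rewrite AvE enum_rankK_in // subr_gt0; apply: lt_le_trans (Au_ge0 _).
  rewrite (bigD1 y) //=; apply: ltr_wnDr.
    by apply: sumr_le0 => j /andP[jT _]; apply: term_le0.
  rewrite pmulr_llt0 // ltrz0 lt_neqAle Axy Ale //.
  by apply: contraNneq yT => <-.
Qed.

End FiniteAffine.

(** * Uniqueness of the type *)

Section Types.

Variable R : realType.

Lemma typeN_standing n (A : 'M[int]_n) k : typeN R A k -> standing R A.
Proof. by case=> [[]|[]|[]|]. Qed.

Lemma typeN_castmx m n (e : m = n) (A : 'M[int]_m) k :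
  typeN R (castmx (e, e) A) k <-> typeN R A k.
Proof. by case: n / e; rewrite castmx_id. Qed.

(** The floor 2 is for small [k]: submatrices of a finite matrix are again of type 0, so a bound by
    [k] alone would fail. It is harmless when comparing with [k.-1] for [k > 2]. *)
Lemma typeN_psubmx n (A : 'M[int]_n) k (T : {set 'I_n}) :
  typeN R A k -> T \proper [set: 'I_n] -> indecomposable (psubmx T A) ->
  exists2 m, (m < maxn k 2)%N & typeN R (psubmx T A) m.
Proof.
case=> {k} [[stA _ [u u_gt0 Au_gt0] _]|[stA _ [u u_gt0 Au0] _]|[_ _ _ sub2]|].
- move=> TT indecT; exists 0%N => //; apply: typeN_finite.
  by apply: psubmx_finite_type TT indecT => // i; rewrite ltW.
- move=> TT indecT; exists 0%N => //; apply: typeN_finite.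
  by apply: psubmx_finite_type TT indecT => // i; rewrite Au0 mxE.
- move=> TT /(sub2 _ TT)[]; first by exists 0%N => //; apply: typeN_finite.
  by exists 1%N => //; apply: typeN_affine.
move=> k S k_gt2 stA SS typeS sub_k TT indecT.
have [->|/sub_k] := eqVneq T S.
  by exists k.-1 => //; rewrite leq_max prednK ?leqnn ?(leq_trans _ k_gt2).
by case=> // m ltmk typeT; exists m; rewrite ?leq_max ?ltmk.
Qed.

Lemma typeN0 n (A : 'M[int]_n) : typeN R A 0 -> finite_type R A.
Proof. by move=> typeA; inversion typeA. Qed.

Lemma typeN1 n (A : 'M[int]_n) : typeN R A 1 -> affine_type R A.
Proof. by move=> typeA; inversion typeA. Qed.

Lemma finite_type_not_affine n (A : 'M[int]_n) :
  finite_type R A -> ~ affine_type R A.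
Proof.
move=> [_ detA _ _] [_ + _ _].
by rewrite mxrank_unit ?subnn // unitmxE det_map_mx unitfE intr_eq0.
Qed.

(** For [k > 2] the submatrix on [S] has type [k.-1], but also, inside a matrix of type [j], some
    type below [maxn j 2 <= k.-1]: the same conflict in smaller dimension. For [k <= 2] the
    definitions exclude each other. *)
Lemma typeN_lt_absurd n (A : 'M[int]_n) j k :
  typeN R A j -> typeN R A k -> ~ (j < k)%N.
Proof.
elim/ltn_ind: n A j k => n IHn A j k typej typek.
case: typek => {k} [//|affA|[_ nfinA naffA _]|k S k_gt2 _ SS typeS _ ltjk].
- by case: j typej => // /typeN0 /finite_type_not_affine/(_ affA).
- case: j typej => [/typeN0 //|[/typeN1 //|//]].
have [_ _ indecS] := typeN_standing typeS.
have [m ltm typem] := typeN_psubmx typej SS indecS.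
apply: IHn typem typeS _.
  by rewrite -[X in (_ < X)%N]card_ord -cardsT proper_card.
case: k k_gt2 ltjk => // k k_gt2 ltjk.
by apply: leq_trans ltm _; rewrite geq_max -ltnS ltjk.
Qed.

End Types.

Theorem theorem3p1 (R : realType) (k n l : nat) (A : 'M[int]_l)
  (hk : (2 < k)%N) (hn : (0 < n)%N)
  (hA : standing R A) (hAkn : typeNd R k n A) :
  exists2 S : {set 'I_l}, S \proper [set: 'I_l] &
    typeNd R (k - 1) (n - 1) (psubmx S A).
Proof.
case: hAkn => typeA <- {n hn}; have [gcmA _ indecA] := hA.
case: typeA hk => // {}k S _ _ SS typeS sub_k k_gt2.
exists S => //; rewrite !subn1; split=> //.
have ltSl : (#|S| < l)%N.
  by rewrite -[X in (_ < X)%N]card_ord -cardsT proper_card.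
have l_gt0 : (0 < l)%N by apply: leq_ltn_trans ltSl.
(* Only [l.-1 <= #|S|] remains; its negation leaves room for one more vertex. *)
apply/eqP; rewrite eqn_leq -ltnS prednK // ltSl /=.
rewrite leqNgt; apply/negP=> ltSl1.
have [_ _ indecS] := typeN_standing typeS.
have [i [j [iS jS Aij]]] :=
  indecomposable_edge gcmA indecA (indecomposable_psubmx_neq0 indecS)
    (etrans (esym (properT _)) SS).
set T := j |: S; have cardT : #|T| = #|S|.+1 by rewrite cardsU1 jS.
have indecT : indecomposable (psubmx T A) by apply: indecomposable_psubmxU1 Aij.
have [||//|m ltmk typeT] := sub_k T.
- rewrite properEcard subsetT cardsT card_ord cardT.
  by rewrite -ltn_predRL.
- by apply: contraTneq jS => <-; rewrite negbK setU11.
(* [S] is re-indexed inside [T], so that the type of [psubmx T A] bounds that of [psubmx S A]. *)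
have [S' [e defS]] := psubmx_nested A (subsetUr [set j] S : S \subset T).
have typeS' : typeN R (psubmx S' (psubmx T A)) k.-1.
  by apply/(typeN_castmx R e); rewrite defS.
have [_ _ indecS'] := typeN_standing typeS'.
have [|m' ltm' typem'] := typeN_psubmx typeT _ indecS'.
  by rewrite properEcard subsetT cardsT card_ord e cardT ltnSn.
apply: typeN_lt_absurd typem' typeS' _.
(* [maxn m 2 <= k.-1] follows from [m < k] and [2 < k]. *)
apply: leq_trans ltm' _.
case: k k_gt2 ltmk {typeS sub_k} => // k k_gt2 ltmk.
by rewrite geq_max -ltnS ltmk.
Qed.
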